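(* Let $\ell:[a,b]\to Gr(kn,2kn)$ be the Jacobi curve of $\mathcal{Q}$. Then the rank of $\ell(t)$ is $n$ (at every $t\in[a,b]$).
   Context: Let $a<b$ be real and $k,n\ge1$. Let $M_{ii}$ ($0\le i\le k$) and $M_{i(i+1)}$ ($0\le i\le k-1$) be smooth functions $[a,b]\to\mathbb{R}^{n\times n}$ with every $M_{ii}(t)$ symmetric and $M_{kk}(t)$ positive definite for all $t$ (strong Legendre condition). Put $$L(t,q_0,\dots,q_k)=\tfrac12\sum_{i=0}^kq_i^{\top}M_{ii}(t)q_i+\sum_{i=0}^{k-1}q_i^{\top}M_{i(i+1)}(t)q_{i+1},\qquad \mathcal{Q}[h]=\int_a^bL(t,h,\dot h,\dots,h^{(k)})\,dt .$$ The Jacobi (Euler-Lagrange) equation of $\mathcal{Q}$ is $\sum_{j=0}^k(-1)^j\frac{d^j}{dt^j}\Big(\frac{\partial L}{\partial q_j}(t,h,\dots,h^{(k)})\Big)=0$, a linear ODE of order $2k$ for $h:[a,b]\to\mathbb{R}^n$. Let $\{h_1,\dots,h_{2kn}\}$ be a fundamental set of solutions (basis of the solution space) of the Jacobi equation such that $h_i^{(j)}(a)=0$ for $1\le i\le kn$ and $0\le j\le k-1$, and let $\mathcal{A}(t)$ be the $2kn\times n$ matrix whose $i$-th row is $h_i(t)^{\top}$. The Jacobi curve $\ell(t)\in Gr(kn,2kn)$ is the span of the columns of the $2kn\times kn$ matrix $(\mathcal{A}(t)|\dot{\mathcal{A}}(t)|\cdots|\mathcal{A}^{(k-1)}(t))$.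 The rank of a smooth curve $\ell$ in a Grassmannian of subspaces of $V$ at $t$ is the rank of $\ell'(t)$, viewed as an element of $\operatorname{Hom}(\ell(t),V/\ell(t))$ via the canonical identification of the tangent space: $\ell'(t_0)$ sends $v\in\ell(t_0)$ to the class of $\tilde v'(t_0)$ in $V/\ell(t_0)$, for any smooth $\tilde v$ with $\tilde v(t)\in\ell(t)$ and $\tilde v(t_0)=v$. *)

(* Defs.v *)
From mathcomp Require Import all_boot all_order all_algebra.
From mathcomp Require Import all_classical all_reals all_analysis.

Set Implicit Arguments.
Unset Strict Implicit.
Unset Printing Implicit Defensive.

Import Order.TTheory GRing.Theory Num.Theory.
Import numFieldNormedType.Exports.

Local Open Scope classical_set_scope.
Local Open Scope ring_scope.

(* Functions on [a, b] are total functions on R whose values outside [a, b]   *)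
(* are never used: for t in [a, b] the limit below is taken along s in [a, b] *)
(* only, hence is one-sided at the endpoints.                                 *)

Section Calculus.
Context {R : realType} {p q : nat}.
Variables (a b : R).
Implicit Type f : R -> 'M[R]_(p, q).

Definition diff_quot f (t : R) : R -> 'M[R]_(p, q) :=
  fun s => (s - t)^-1 *: (f s - f t).

Definition derivable_on f (t : R) : Prop :=
  cvg (diff_quot f t @ within `[a, b] t^').

Definition deriv_on f (t : R) : 'M[R]_(p, q) :=
  lim (diff_quot f t @ within `[a, b] t^').

Definition derivn_on (j : nat) f : R -> 'M[R]_(p, q) := iter j deriv_on f.

Definition derivable_n_on (m : nat) f : Prop :=
  forall (j : nat) (t : R), (j < m)%N -> t \in `[a, b] ->
    derivable_on (derivn_on j f) t.

Definition smooth_on f : Prop := forall m : nat, derivable_n_on m f.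

End Calculus.

Section Jacobi.
Context {R : realType} {n : nat}.
Variables (a b : R) (k : nat).
(* Mdiag i is M_{ii}, used for i <= k; Moff i is M_{i(i+1)}, used for i < k. *)
Variables (Mdiag Moff : nat -> R -> 'M[R]_n).

Definition posdef (S : 'M[R]_n) : Prop :=
  forall v : 'cV[R]_n, v != 0 -> 0 < (v^T *m S *m v) 0 0.

(* Only q 0, ..., q k matter. *)
Definition lagrangian (t : R) (q : nat -> 'cV[R]_n) : R :=
  2^-1 * (\sum_(i < k.+1) ((q i)^T *m Mdiag i t *m q i) 0 0)
  + \sum_(i < k) ((q i)^T *m Moff i t *m q i.+1) 0 0.

(* The gradient dL/dq_j (t, q), as a column of partial derivatives. *)
Definition lagrangian_grad (j : nat) (t : R) (q : nat -> 'cV[R]_n) : 'cV[R]_n :=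
  \col_m derive1 (fun s : R => lagrangian t
            (fun i => if i == j then q i + s *: delta_mx m 0 else q i)) 0.

Definition jacobi_lhs (h : R -> 'cV[R]_n) (t : R) : 'cV[R]_n :=
  \sum_(j < k.+1) (-1) ^+ j *:
    derivn_on a b j
      (fun s => lagrangian_grad j s (fun i => derivn_on a b i h s)) t.

Definition jacobi_solution (h : R -> 'cV[R]_n) : Prop :=
  derivable_n_on a b (2 * k) h /\
  forall t : R, t \in `[a, b] -> jacobi_lhs h t = 0.

Definition fundamental_set (N : nat) (h : 'I_N -> R -> 'cV[R]_n) : Prop :=
  [/\ forall i, jacobi_solution (h i),
      forall c : 'I_N -> R,
        (forall t, t \in `[a, b] -> \sum_i c i *: h i t = 0) ->
        forall i, c i = 0
    & forall g, jacobi_solution g ->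
        exists c : 'I_N -> R,
          forall t, t \in `[a, b] -> g t = \sum_i c i *: h i t].

End Jacobi.

Section JacobiCurve.
Context {R : realType} {n N : nat}.
Variables (a b : R) (k : nat) (h : 'I_N -> R -> 'cV[R]_n).

Definition sol_mx (t : R) : 'M[R]_(N, n) := \matrix_(i, m) h i t m 0.

Definition col_span (q : nat) (B : 'M[R]_(N, q)) : {vspace 'cV[R]_N} :=
  <<[seq col j B | j <- enum 'I_q]>>%VS.

Definition jacobi_curve (t : R) : {vspace 'cV[R]_N} :=
  col_span (\mxrow_(j < k) derivn_on a b j sol_mx t).

End JacobiCurve.

(* V / U is modelled by a complement of U; the canonical projection V -> V/U  *)
(* becomes the projection along U, which is onto with kernel U.               *)

Section Quotient.
Context {K : fieldType} {V : vectType K}.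
Variable U : {vspace V}.

Definition quot_space := subvs_of (U^C)%VS.

Definition quot_proj : 'Hom(V, quot_space) :=
  (linfun (vsproj (U^C)%VS) \o (\1 - projv U))%VF.

Lemma vsval_quot_proj v : vsval (quot_proj v) = v - projv U v.
Proof.
by rewrite comp_lfunE !lfunE /= opp_lfunE vsprojK ?lfunE /= ?memv_projC.
Qed.

Lemma quot_proj_lker : lker quot_proj = U.
Proof.
apply/vspaceP => v; rewrite memv_ker -(inj_eq subvs_inj) vsval_quot_proj linear0.
rewrite subr_eq0; apply/eqP/idP => [-> | vU]; first exact: memv_proj.
by rewrite projv_id.
Qed.

Lemma quot_proj_limg : limg quot_proj = fullv.
Proof.
apply/eqP; rewrite eqEsubv subvf /=; apply/subvP => w _.
apply/memv_imgP; exists (vsval w); first exact: memvf.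
apply: subvs_inj; rewrite vsval_quot_proj.
suff -> : projv U (vsval w) = 0 by rewrite subr0.
by apply/eqP; rewrite -memv_ker lker_proj; exact: subvsP.
Qed.

End Quotient.

Section GrassmannCurves.
Context {R : realType} {N : nat}.
Variables (a b : R) (l : R -> {vspace 'cV[R]_N}).

(* A smooth curve [a, b] -> Gr(d, R^N): over an interval smoothness amounts   *)
(* to the existence of a smooth moving basis.                                 *)
Definition smooth_gr_curve (d : nat) : Prop :=
  exists2 e : 'I_d -> R -> 'cV[R]_N,
    forall i, smooth_on a b (e i)
    & forall t, t \in `[a, b] -> basis_of (l t) [seq e i t | i <- enum 'I_d].

Definition smooth_section (f : R -> 'cV[R]_N) : Prop :=
  smooth_on a b f /\ forall t, t \in `[a, b] -> f t \in l t.

(* D is l'(t), an element of Hom(l(t), V/l(t)). *)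
Definition curve_velocity (t : R)
    (D : 'Hom(subvs_of (l t), quot_space (l t))) : Prop :=
  forall v : subvs_of (l t),
    (exists2 f, smooth_section f & f t = vsval v) /\
    (forall f, smooth_section f -> f t = vsval v ->
       D v = quot_proj (l t) (deriv_on a b f t)).

Definition curve_rank_eq (t : R) (r : nat) : Prop :=
  exists2 D, curve_velocity (t := t) D & \dim (limg D) = r.

End GrassmannCurves.

(* Main.v *)
Require Import Defs.
From mathcomp Require Import all_boot all_order all_algebra.
From mathcomp Require Import all_classical all_reals all_analysis.
From mathcomp Require Import ring lra zify.

(** The Jacobi curve moves by differentiating the columns of A, and each
    derivative only pushes the last block A^(k-1) out of l(t), into A^(k).

    Positive definiteness of M_kk turns the Jacobi equation into an explicit
    system h^(2k) = sum_(i < 2k) G_i h^(i) with smooth G_i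
    ([jacobi_normal_form]).  Two consequences are needed.  Solutions, which are
    only assumed 2k times differentiable, are smooth by bootstrapping
    ([jacobi_smooth]).  The square Wronskian W = (A | A' | ... | A^(2k-1))
    solves a linear first-order system W' = W B, so a row combination c W that
    vanishes at one time vanishes at all times by Gronwall's inequality
    ([linear_ode_zero]); as the h_i are linearly independent functions, W(t)
    is invertible for every t ([wronskian_unit]).

    The rows of W(t)^-1, cut into blocks P_i(t), form a smooth frame dual to
    the A^(j)(t), that is P_i A^(j) = delta_ij ([dual_frame]).  Everything else
    only uses A, P_0, ..., P_k and this duality.  The columns of A, ...,
    A^(k-1) are a smooth moving basis of l ([frame_smooth]).  A smooth section
    is f = sum_(j < k) A^(j) (P_j f), so that modulo l(t)
      f'(t) = A^(k)(t) P_(k-1)(t) f(t),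
    all other terms of the product rule lying in l(t) ([section_deriv]).  Hence
    l'(t) is the map v |-> [A^(k)(t) P_(k-1)(t) v].  Its image is the
    column space of A^(k)(t) modulo l(t), which has dimension n because P_k(t)
    annihilates l(t) and is a left inverse of A^(k)(t) ([frame_rank]). *)

Set Implicit Arguments.
Unset Strict Implicit.
Unset Printing Implicit Defensive.

Import Order.TTheory GRing.Theory Num.Theory.
Import numFieldNormedType.Exports.

Local Open Scope classical_set_scope.
Local Open Scope ring_scope.

(** * Limits and first derivatives of matrix-valued functions on a segment *)

Section MatrixLimits.
Context {R : realType} {T : Type} {F : set_system T} {FF : Filter F}.

Lemma near_cvg_eq (U : topologicalType) (f g : T -> U) (l : U) :
  (\forall x \near F, f x = g x) ->
  f x @[x --> F] --> l -> g x @[x --> F] --> l.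
Proof. by move=> fg; apply: cvg_trans; exact: near_eq_cvg. Qed.

Lemma cvg_mxP p q (f : T -> 'M[R]_(p, q)) (l : 'M[R]_(p, q)) :
  f x @[x --> F] --> l <-> forall i j, f x i j @[x --> F] --> l i j.
Proof.
split=> [fl i j|fl].
  exact: (cvg_comp _ _ fl (@coord_continuous _ _ _ i j l)).
apply/cvgrPdist_le => /= e e0; near=> x.
rewrite /Num.Def.normr/= mx_normrE (bigmax_le _ (ltW e0))//= => i _.
rewrite !mxE; move: i; near: x; apply: filter_forall => /= i.
exact: ((cvgrPdist_le _ _).1 (fl i.1 i.2)).
Unshelve. all: by end_near. Qed.

Lemma cvg_sum (I : Type) (r : seq I) (P : pred I) (f : I -> T -> R)
    (l : I -> R) :
  (forall i, P i -> f i x @[x --> F] --> l i) ->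
  \sum_(i <- r | P i) f i x @[x --> F] --> \sum_(i <- r | P i) l i.
Proof.
by apply: cvg_big; move=> [x y]; apply: (@add_continuous R).
Qed.

Lemma cvg_prodr (I : Type) (r : seq I) (P : pred I) (f : I -> T -> R)
    (l : I -> R) :
  (forall i, P i -> f i x @[x --> F] --> l i) ->
  \prod_(i <- r | P i) f i x @[x --> F] --> \prod_(i <- r | P i) l i.
Proof.
by apply: cvg_big; move=> [x y]; apply: mul_continuous.
Qed.

Lemma cvg_mulmx p q r (f : T -> 'M[R]_(p, q)) (g : T -> 'M[R]_(q, r))
    (l : 'M[R]_(p, q)) (m : 'M[R]_(q, r)) :
  f x @[x --> F] --> l -> g x @[x --> F] --> m ->
  f x *m g x @[x --> F] --> l *m m.
Proof.
move=> /cvg_mxP fl /cvg_mxP gm; apply/cvg_mxP => i j; rewrite mxE.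
under eq_cvg do rewrite mxE.
by apply: cvg_sum => k _; apply: cvgM.
Qed.

Lemma cvg_det p (f : T -> 'M[R]_p) (l : 'M[R]_p) :
  f x @[x --> F] --> l -> \det (f x) @[x --> F] --> \det l.
Proof.
move=> /cvg_mxP fl; rewrite /determinant.
apply: cvg_sum => s _; apply: cvgM; first exact: cvg_cst.
by apply: cvg_prodr => i _.
Qed.

(** Cramer's formula makes the inverse a continuous function of the entries
    near an invertible matrix. *)
Lemma cvg_invmx p (f : T -> 'M[R]_p) (l : 'M[R]_p) : l \in unitmx ->
  f x @[x --> F] --> l -> (invmx (f x)) @[x --> F] --> invmx l.
Proof.
move=> ul fl; have fdet := cvg_det fl.
have dl0 : \det l != 0 by rewrite -unitfE -unitmxE.
have dnz : \forall x \near F, \det (f x) != 0.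
  exact: (cvgr_neq0 _ fdet).
rewrite {2}/invmx ul.
apply: (near_cvg_eq (f := fun x => (\det (f x))^-1 *: \adj (f x))).
  near=> x; rewrite /invmx unitmxE unitfE.
  by rewrite (_ : \det (f x) != 0 = true)//; near: x.
apply: cvgZ; first exact: cvgV.
apply/cvg_mxP => i j; rewrite mxE; under eq_cvg do rewrite mxE.
apply: cvgM; first exact: cvg_cst.
apply: cvg_det; apply/cvg_mxP => i' j'; rewrite !mxE.
under eq_cvg do rewrite !mxE.
exact: (cvg_mxP _ _).1.
Unshelve. all: by end_near. Qed.

End MatrixLimits.

Section DerivativeOnInterval.
Context {R : realType}.
Variables (a b : R).
Hypothesis ab : a < b.

(** The punctured filter within [a, b] makes the derivative one-sided at the
    endpoints.  Working with this relation, instead of the total operator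
    [deriv_on], keeps limits composable. *)
Definition deriv_at p q (f : R -> 'M[R]_(p, q)) (t : R) (l : 'M[R]_(p, q)) :=
  diff_quot f t s @[s --> within `[a, b] t^'] --> l.

(** This is where a < b enters: every point of [a, b] is a limit of other points
    of [a, b], so derivatives along [a, b] are unique. *)
Lemma itv_dnbhs_proper t : t \in `[a, b] -> ProperFilter (within `[a, b] t^').
Proof.
rewrite in_itv/= => /andP[at_ tb].
apply: Build_ProperFilter_ex => U [e /= e0 eU].
have [tltb|blet] := ltP t b.
  pose d := Num.min (e / 2) (b - t).
  have d0 : 0 < d by rewrite lt_min divr_gt0//= subr_gt0.
  have de : d < e by rewrite gt_min ltr_pdivrMr// ltr_pMr// ltr1n.
  exists (t + d); apply: eU => /=.
  - by rewrite opprD addrA subrr sub0r normrN gtr0_norm.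
  - by rewrite gt_eqF// ltrDl.
  have dbt : d <= b - t by rewrite ge_min lexx orbT.
  by rewrite in_itv/=; apply/andP; split; lra.
have alt : a < t by apply: lt_le_trans blet.
pose d := Num.min (e / 2) (t - a).
have d0 : 0 < d by rewrite lt_min divr_gt0//= subr_gt0.
have de : d < e by rewrite gt_min ltr_pdivrMr// ltr_pMr// ltr1n.
exists (t - d); apply: eU => /=.
- by rewrite opprB addrC subrK gtr0_norm.
- by rewrite lt_eqF// ltrBlDr ltrDl.
have dta : d <= t - a by rewrite ge_min lexx orbT.
by rewrite in_itv/=; apply/andP; split; lra.
Qed.

Lemma deriv_onE p q (f : R -> 'M[R]_(p, q)) t l :
  t \in `[a, b] -> deriv_at f t l -> deriv_on a b f t = l.
Proof.
move=> tab fl; have FP := itv_dnbhs_proper tab.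
exact: (cvg_lim (@norm_hausdorff _ _) fl).
Qed.

Lemma deriv_at_derivable p q (f : R -> 'M[R]_(p, q)) t l :
  t \in `[a, b] -> deriv_at f t l -> derivable_on a b f t.
Proof.
by move=> tab fl; rewrite /derivable_on [X in _ --> X](deriv_onE tab fl).
Qed.

Lemma eq_deriv_at p q (f g : R -> 'M[R]_(p, q)) t l : t \in `[a, b] ->
  {in `[a, b], f =1 g} -> deriv_at f t l -> deriv_at g t l.
Proof.
move=> tab fg fl; apply: near_cvg_eq fl.
apply: filterS (withinT _ _) => s /= sab.
by rewrite /diff_quot !fg.
Qed.

Lemma deriv_at_cvg p q (f : R -> 'M[R]_(p, q)) t l :
  deriv_at f t l -> f s @[s --> within `[a, b] t^'] --> f t.
Proof.
move=> fl; have cst : f t @[_ --> within `[a, b] t^'] --> f t by exact: cvg_cst.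
have st : (s - t) @[s --> within `[a, b] t^'] --> (0 : R).
  rewrite -(subrr t); apply: cvgB; last exact: cvg_cst.
  move=> U /(cvg_within (fun y => y != t)) Ut.
  exact: (@cvg_within _ (t^') _ _ _ Ut).
have FF : Filter (within `[a, b] t^') by apply: within_filter.
have := cvgD (FF := FF) (cvgZ (FF := FF) st fl) cst.
rewrite scale0r add0r; apply: near_cvg_eq.
have st0 : \forall s \near within `[a, b] t^', s != t.
  by apply: (@cvg_within _ (t^')); exact: (withinT (fun s => s != t)).
near=> s.
rewrite /diff_quot scalerA divff ?scale1r ?subrK// subr_eq0.
by near: s.
Unshelve. all: by end_near. Qed.

Lemma deriv_at_cst p q (c : 'M[R]_(p, q)) t : deriv_at (fun=> c) t 0.
Proof.
rewrite /deriv_at /diff_quot; under eq_cvg do rewrite subrr scaler0.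
exact: cvg_cst.
Qed.

Lemma deriv_atD p q (f g : R -> 'M[R]_(p, q)) t l m :
  deriv_at f t l -> deriv_at g t m -> deriv_at (fun s => f s + g s) t (l + m).
Proof.
move=> fl gm; have FF : Filter (within `[a, b] t^') by apply: within_filter.
have := cvgD (FF := FF) fl gm; rewrite /deriv_at; apply: cvg_trans.
by apply: near_eq_cvg; near=> s; rewrite /diff_quot /= opprD addrACA scalerDr.
Unshelve. all: by end_near. Qed.

Lemma deriv_at_tr p q (f : R -> 'M[R]_(p, q)) t l :
  deriv_at f t l -> deriv_at (fun s => (f s)^T) t l^T.
Proof.
move=> /cvg_mxP fl; apply/cvg_mxP => i j; rewrite mxE.
move: (fl j i); apply: near_cvg_eq; near=> s.
by rewrite !mxE.
Unshelve. all: by end_near. Qed.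

Lemma deriv_atM p q r (f : R -> 'M[R]_(p, q)) (g : R -> 'M[R]_(q, r)) t l m :
  deriv_at f t l -> deriv_at g t m ->
  deriv_at (fun s => f s *m g s) t (l *m g t + f t *m m).
Proof.
move=> fl gm; have fc := deriv_at_cvg fl.
have gt : g t @[_ --> within `[a, b] t^'] --> g t by exact: cvg_cst.
have FF : Filter (within `[a, b] t^') by apply: within_filter.
have := cvgD (FF := FF)
  (cvg_mulmx (FF := FF) fl gt) (cvg_mulmx (FF := FF) fc gm).
rewrite /deriv_at; apply: near_cvg_eq; near=> s.
rewrite /diff_quot /= -scalemxAl -scalemxAr -scalerDr mulmxBl mulmxBr.
by congr (_ *: _); rewrite addrC subrKA.
Unshelve. all: by end_near. Qed.

(** From X^-1 - Y^-1 = - X^-1 (X - Y) Y^-1, which reduces the derivative of the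
    inverse to its continuity. *)
Lemma deriv_at_inv p (f : R -> 'M[R]_p) t l : t \in `[a, b] ->
  {in `[a, b], forall s, f s \in unitmx} -> deriv_at f t l ->
  deriv_at (fun s => invmx (f s)) t (- (invmx (f t) *m l *m invmx (f t))).
Proof.
move=> tab fu fl.
have ic : invmx (f s) @[s --> within `[a, b] t^'] --> invmx (f t).
  by apply: cvg_invmx (deriv_at_cvg fl); exact: fu.
have FF : Filter (within `[a, b] t^') by apply: within_filter.
have cst : invmx (f t) @[_ --> within `[a, b] t^'] --> invmx (f t).
  exact: cvg_cst.
have := cvgN (FF := FF)
  (cvg_mulmx (FF := FF) (cvg_mulmx (FF := FF) ic fl) cst).
apply: near_cvg_eq.
apply: filterS (withinT _ _) => s /= sab.
rewrite /diff_quot /= -scalemxAr -scalemxAl -scalerN mulmxBr mulmxBl.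
by rewrite mulVmx ?fu// mul1mx -mulmxA mulmxV ?fu// mulmx1 opprB.
Qed.

End DerivativeOnInterval.

(** * Higher derivatives and stability of differentiability classes *)

Section HigherDerivatives.
Context {R : realType}.
Variables (a b : R).
Hypothesis ab : a < b.

Lemma derivn_on0 p q (f : R -> 'M[R]_(p, q)) : derivn_on a b 0 f = f.
Proof. by []. Qed.

Lemma derivn_onS p q (f : R -> 'M[R]_(p, q)) j :
  derivn_on a b j.+1 f = deriv_on a b (derivn_on a b j f).
Proof. by []. Qed.

Lemma derivn_onD p q (f : R -> 'M[R]_(p, q)) i j :
  derivn_on a b (i + j) f = derivn_on a b i (derivn_on a b j f).
Proof. exact: iterD. Qed.

Lemma eq_deriv_on p q (f g : R -> 'M[R]_(p, q)) :
  {in `[a, b], f =1 g} -> {in `[a, b], deriv_on a b f =1 deriv_on a b g}.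
Proof.
move=> fg t tab; rewrite /deriv_on; congr (lim _).
by rewrite eqEsubset; split; apply: near_eq_cvg;
   apply: filterS (withinT _ _) => s /= sab; rewrite /diff_quot !fg.
Qed.

Lemma eq_derivn_on p q (f g : R -> 'M[R]_(p, q)) j : {in `[a, b], f =1 g} ->
  {in `[a, b], derivn_on a b j f =1 derivn_on a b j g}.
Proof. by move=> fg; elim: j => // j IH; exact: eq_deriv_on. Qed.

Lemma derivn_deriv_at p q (f : R -> 'M[R]_(p, q)) m j t :
  derivable_n_on a b m f -> (j < m)%N -> t \in `[a, b] ->
  deriv_at a b (derivn_on a b j f) t (derivn_on a b j.+1 f t).
Proof. by move=> fm jm tab; exact: fm. Qed.

Lemma deriv_atS p q (f : R -> 'M[R]_(p, q)) m t :
  derivable_n_on a b m.+1 f -> t \in `[a, b] ->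
  deriv_at a b f t (deriv_on a b f t).
Proof. by move=> fm tab; exact: (derivn_deriv_at (j := 0) fm). Qed.

Lemma derivable_n_onW p q (f : R -> 'M[R]_(p, q)) m m' : (m' <= m)%N ->
  derivable_n_on a b m f -> derivable_n_on a b m' f.
Proof. by move=> m'm fm j t jm'; apply: fm; exact: leq_trans m'm. Qed.

Lemma derivable_n_on_derivn p q (f : R -> 'M[R]_(p, q)) m j :
  derivable_n_on a b (m + j) f -> derivable_n_on a b m (derivn_on a b j f).
Proof.
by move=> fm i t im tab; rewrite -derivn_onD; apply: fm; rewrite ?ltn_add2r.
Qed.

Lemma derivable_n_onD p q (f : R -> 'M[R]_(p, q)) m j :
  derivable_n_on a b j f -> derivable_n_on a b m (derivn_on a b j f) ->
  derivable_n_on a b (m + j) f.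
Proof.
move=> fj fm i t im tab; have [ij|ji] := ltnP i j; first exact: fj.
by rewrite -(subnK ji) derivn_onD; apply: fm; rewrite // ltn_subLR // addnC.
Qed.

(** The induction step behind all closure properties below: it suffices to
    exhibit a derivative lying in the previous class. *)
Lemma derivable_n_onS p q (f g : R -> 'M[R]_(p, q)) m :
  (forall t, t \in `[a, b] -> deriv_at a b f t (g t)) ->
  derivable_n_on a b m g -> derivable_n_on a b m.+1 f.
Proof.
move=> fg gm; rewrite -addn1; apply: derivable_n_onD => [[|//] t _ tab|].
  exact: (deriv_at_derivable ab tab (fg t tab)).
move=> j t jm tab.
have gf : {in `[a, b], g =1 derivn_on a b 1 f}.
  by move=> s sab; rewrite /= (deriv_onE ab sab (fg s sab)).
have := derivn_deriv_at gm jm tab.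
move=> /(eq_deriv_at tab (eq_derivn_on j gf)).
exact: (deriv_at_derivable ab tab).
Qed.

Lemma derivable_n_on_deriv p q (f : R -> 'M[R]_(p, q)) m :
  derivable_n_on a b m.+1 f -> derivable_n_on a b m (deriv_on a b f).
Proof. by rewrite -addn1 => /derivable_n_on_derivn. Qed.

Lemma eq_derivable_n_on p q (f g : R -> 'M[R]_(p, q)) m :
  {in `[a, b], f =1 g} -> derivable_n_on a b m f -> derivable_n_on a b m g.
Proof.
move=> fg fm j t jm tab.
have := eq_deriv_at tab (eq_derivn_on j fg) (derivn_deriv_at fm jm tab).
exact: (deriv_at_derivable ab tab).
Qed.

Lemma derivable_n_on0 p q (f : R -> 'M[R]_(p, q)) : derivable_n_on a b 0 f.
Proof. by []. Qed.

Lemma derivable_n_on_cst p q (c : 'M[R]_(p, q)) m :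
  derivable_n_on a b m (fun=> c).
Proof.
elim: m c => [*|m IH c]; first exact: derivable_n_on0.
apply: derivable_n_onS (IH 0) => t tab.
exact: deriv_at_cst.
Qed.

Lemma derivable_n_on_add p q (f g : R -> 'M[R]_(p, q)) m :
  derivable_n_on a b m f -> derivable_n_on a b m g ->
  derivable_n_on a b m (fun s => f s + g s).
Proof.
elim: m f g => [*|m IH f g fm gm]; first exact: derivable_n_on0.
apply: derivable_n_onS
  (IH _ _ (derivable_n_on_deriv fm) (derivable_n_on_deriv gm)) => t tab.
exact: (deriv_atD (deriv_atS fm tab) (deriv_atS gm tab)).
Qed.

Lemma derivable_n_on_sum (I : Type) (r : seq I) p q
  (f : I -> R -> 'M[R]_(p, q)) m :
  (forall i, derivable_n_on a b m (f i)) ->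
  derivable_n_on a b m (fun s => \sum_(i <- r) f i s).
Proof.
move=> fm; elim: r => [|i r IH].
  apply: (@eq_derivable_n_on _ _ (fun=> 0)); last exact: derivable_n_on_cst.
  by move=> s _; rewrite big_nil.
apply: eq_derivable_n_on (derivable_n_on_add (fm i) IH) => s _.
by rewrite big_cons.
Qed.

Lemma derivable_n_on_tr p q (f : R -> 'M[R]_(p, q)) m :
  derivable_n_on a b m f -> derivable_n_on a b m (fun s => (f s)^T).
Proof.
elim: m f => [*|m IH f fm]; first exact: derivable_n_on0.
apply: derivable_n_onS (IH _ (derivable_n_on_deriv fm)) => t tab.
exact: (deriv_at_tr (deriv_atS fm tab)).
Qed.

Lemma derivable_n_on_mul p q r (f : R -> 'M[R]_(p, q)) (g : R -> 'M[R]_(q, r))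
    m : derivable_n_on a b m f -> derivable_n_on a b m g ->
  derivable_n_on a b m (fun s => f s *m g s).
Proof.
elim: m f g => [*|m IH f g fm gm]; first exact: derivable_n_on0.
have fm' := derivable_n_onW (leqnSn m) fm.
have gm' := derivable_n_onW (leqnSn m) gm.
apply: derivable_n_onS (derivable_n_on_add
  (IH _ _ (derivable_n_on_deriv fm) gm')
  (IH _ _ fm' (derivable_n_on_deriv gm))).
by move=> t tab; exact: (deriv_atM (deriv_atS fm tab) (deriv_atS gm tab)).
Qed.

Lemma derivable_n_on_opp p q (f : R -> 'M[R]_(p, q)) m :
  derivable_n_on a b m f -> derivable_n_on a b m (fun s => - f s).
Proof.
move=> fm; apply: (@eq_derivable_n_on _ _ (fun s => - 1%:M *m f s)).
  by move=> s _; rewrite mulNmx mul1mx.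
by apply: derivable_n_on_mul; first exact: derivable_n_on_cst.
Qed.

(** Induction on m: the derivative - X^-1 X' X^-1 only involves X^-1 with one
    order of differentiability less. *)
Lemma derivable_n_on_inv p (f : R -> 'M[R]_p) m :
  {in `[a, b], forall s, f s \in unitmx} ->
  derivable_n_on a b m f -> derivable_n_on a b m (fun s => invmx (f s)).
Proof.
move=> fu; elim: m => [*|m IH fm]; first exact: derivable_n_on0.
have im := IH (derivable_n_onW (leqnSn m) fm).
apply: derivable_n_onS (derivable_n_on_opp (derivable_n_on_mul
  (derivable_n_on_mul im (derivable_n_on_deriv fm)) im)) => t tab.
exact: (deriv_at_inv tab fu (deriv_atS fm tab)).
Qed.

Lemma deriv_at_sum (I : Type) (r : seq I) p q (f : I -> R -> 'M[R]_(p, q))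
    (l : I -> 'M[R]_(p, q)) t : (forall i, deriv_at a b (f i) t (l i)) ->
  deriv_at a b (fun s => \sum_(i <- r) f i s) t (\sum_(i <- r) l i).
Proof.
move=> fl; rewrite /deriv_at; elim: r => [|i r IH].
  rewrite big_nil; apply: near_cvg_eq (deriv_at_cst _ _ 0 t).
  by apply: nearW => s; rewrite /diff_quot !big_nil.
rewrite big_cons; apply: near_cvg_eq (deriv_atD (fl i) IH).
by apply: nearW => s; rewrite /diff_quot !big_cons.
Qed.

(** A chain of successive derivatives starting at f computes the iterated total
    operators, so iterated derivatives can be identified without limits. *)
Lemma derivn_on_tower p q (F : nat -> R -> 'M[R]_(p, q)) f m :
  {in `[a, b], F 0 =1 f} ->
  (forall i t, (i < m)%N -> t \in `[a, b] -> deriv_at a b (F i) t (F i.+1 t)) ->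
  derivable_n_on a b m f /\
  forall j, (j <= m)%N -> {in `[a, b], derivn_on a b j f =1 F j}.
Proof.
move=> F0f FS.
have eqF j : (j <= m)%N -> {in `[a, b], derivn_on a b j f =1 F j}.
  elim: j => [|j IH] jm t tab; first by rewrite /= F0f.
  rewrite derivn_onS (eq_deriv_on (IH (ltnW jm)) tab).
  exact: (deriv_onE ab tab (FS _ _ jm tab)).
split=> // j t jm tab; apply: (deriv_at_derivable ab tab (l := F j.+1 t)).
apply: eq_deriv_at (FS _ _ jm tab) => // s sab.
by rewrite (eqF j (ltnW jm) s sab).
Qed.

Lemma derivn_on_add p q (f g : R -> 'M[R]_(p, q)) m t :
  derivable_n_on a b m f -> derivable_n_on a b m g -> t \in `[a, b] ->
  derivn_on a b m (fun s => f s + g s) t =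
  derivn_on a b m f t + derivn_on a b m g t.
Proof.
move=> fm gm tab.
have [i s im sab|_ eqm] := @derivn_on_tower _ _
    (fun j s => derivn_on a b j f s + derivn_on a b j g s)
    (fun s => f s + g s) m (fun _ _ => erefl) _.
  exact: (deriv_atD (derivn_deriv_at fm im sab) (derivn_deriv_at gm im sab)).
exact: (eqm m (leqnn m) t tab).
Qed.

Lemma derivn_on_rows N p (h : 'I_N -> R -> 'cV[R]_p) m :
  (forall i, derivable_n_on a b m (h i)) ->
  derivable_n_on a b m (fun s => \matrix_(i, l) h i s l 0) /\
  forall j, (j <= m)%N -> {in `[a, b],
    derivn_on a b j (fun s => \matrix_(i, l) h i s l 0) =1
    fun s => \matrix_(i, l) derivn_on a b j (h i) s l 0}.
Proof.
move=> hm; apply: derivn_on_tower => // i t im tab.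
apply/cvg_mxP => r c; rewrite mxE.
have /cvg_mxP/(_ c 0) := derivn_deriv_at (hm r) im tab.
by apply: near_cvg_eq; apply: nearW => s; rewrite !mxE.
Qed.

End HigherDerivatives.

(** * Uniqueness for linear first-order systems *)

Section Uniqueness.
Context {R : realType}.
Variables (a b : R).
Hypothesis ab : a < b.

(** Adding the point t back to the punctured filter: this is the form of
    continuity that the extreme value and mean value theorems on [a, b] use. *)
Lemma deriv_at_within_cvg p q (f : R -> 'M[R]_(p, q)) t l :
  deriv_at a b f t l -> f s @[s --> within `[a, b] (nbhs t)] --> f t.
Proof.
move=> /deriv_at_cvg/cvgrPdist_lt fc; apply/cvgrPdist_lt => e e0.
have H : nbhs t (fun s => s != t -> s \in `[a, b] -> `|f t - f s| < e).
  exact: fc e e0.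
suff : nbhs t (fun s => s \in `[a, b] -> `|f t - f s| < e) by [].
apply: filterS H => s + sab.
by have [->|st] := eqVneq s t; [rewrite subrr normr0|exact].
Qed.

(** At interior points the derivative along [a, b] is the two-sided one, so the
    monotonicity criteria for real functions apply. *)
Lemma deriv_at_is_derive (f : R -> 'M[R]_1) t l : t \in `]a, b[ ->
  deriv_at a b f t l -> is_derive t 1 (fun s => f s 0 0) (l 0 0).
Proof.
move=> tab /cvg_mxP/(_ 0 0) fl.
have F : h^-1 *: ((f (h *: 1 + t) 0 0 : R) - f t 0 0) @[h --> (0 : R)^'] -->
    (l 0 0 : R).
  apply/cvgrPdist_lt => e e0.
  have /cvgrPdist_lt/(_ e e0)[d/= d0 H] := fl.
  have /= [d' d'0 H'] : nbhs t `]a, b[%classic.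
    by apply: open_nbhs_nbhs; split; [exact: interval_open|].
  exists (Num.min d d'); first by rewrite /= lt_min d0.
  move=> h /=; rewrite sub0r normrN lt_min => /andP[hd hd'] h0.
  have := H (h + t); rewrite /diff_quot !mxE addrK scaler1 => -> //=.
  - by rewrite opprD addrCA subrr addr0 normrN.
  - by rewrite -subr_eq0 addrK.
  - have := H' (h + t) => /=.
    rewrite opprD addrCA subrr addr0 normrN => /(_ hd').
    by rewrite !in_itv/= => /andP[/ltW -> /ltW ->].
apply: DeriveDef; first by apply/cvg_ex; exists (l 0 0).
exact: (cvg_lim (@norm_hausdorff _ _) F).
Qed.

(** Each product satisfies |y_i y_j| <= (y_i^2 + y_j^2) / 2; the double sum of
    the right-hand sides is d |y|^2. *)
Lemma quad_form_bound d (B : 'M[R]_d) (y : 'rV[R]_d) (C : R) :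
  (forall i j, `|B i j| <= C) ->
  `|(y *m B *m y^T) 0 0| <= C * d%:R * (y *m y^T) 0 0.
Proof.
move=> BC.
have -> : C * d%:R * (y *m y^T) 0 0 =
    \sum_(j < d) \sum_(i < d) C * ((y 0 i ^+ 2 + y 0 j ^+ 2) / 2).
  have -> : (y *m y^T) 0 0 = \sum_i y 0 i ^+ 2.
    by rewrite mxE; apply: eq_bigr => i _; rewrite mxE expr2.
  under [RHS]eq_bigr do
    rewrite -mulr_sumr -mulr_suml big_split/= sumr_const card_ord.
  rewrite -mulr_sumr -mulr_suml big_split/= sumr_const card_ord sumrMnl.
  rewrite -mulr_natl.
  by field.
rewrite mxE; apply: le_trans (ler_norm_sum _ _ _) _; apply: ler_sum => j _.
rewrite !mxE mulr_suml.
apply: le_trans (ler_norm_sum _ _ _) _; apply: ler_sum => i _.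
rewrite mulrAC normrM mulrC; apply: ler_pM => //.
rewrite ler_norml; apply/andP; split; have := sqr_ge0 (y 0 i + y 0 j);
have := sqr_ge0 (y 0 i - y 0 j); rewrite sqrrB sqrrD; lra.
Qed.

(** Gronwall's inequality for u = |Y|^2: as |u'| <= D u, the function u e^(D s)
    is nondecreasing and u e^(- D s) is nonincreasing, so u = 0 spreads from t0
    to the left and to the right. *)
Lemma linear_ode_zero d (Y : R -> 'rV[R]_d) (B : R -> 'M[R]_d) t0 t :
  (forall s, s \in `[a, b] -> deriv_at a b Y s (Y s *m B s)) ->
  (forall s, s \in `[a, b] -> derivable_on a b B s) ->
  t0 \in `[a, b] -> Y t0 = 0 -> t \in `[a, b] -> Y t = 0.
Proof.
move=> dY dB t0ab Y0 tab.
(* B is continuous on the compact segment [a, b], hence bounded. *)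
have [C HC] : exists C, forall s, s \in `[a, b] -> forall i j, `|B s i j| <= C.
  have [|c cab Hc] := @EVT_max R (fun s => `|B s|) a b (ltW ab).
    by apply/subspace_continuousP => s sab; apply: cvg_norm;
       exact: deriv_at_within_cvg (dB s sab).
  exists `|B c| => s sab i j; apply: le_trans (Hc s sab).
  by rewrite [leRHS]/Num.Def.normr/= mx_normrE; exact: (le_bigmax _ _ (i, j)).
pose u s := (Y s *m (Y s)^T) 0 0.
pose u' s := (Y s *m B s *m (Y s)^T + Y s *m (Y s *m B s)^T) 0 0.
have du s : s \in `[a, b] -> deriv_at a b (fun s => Y s *m (Y s)^T) s
   (Y s *m B s *m (Y s)^T + Y s *m (Y s *m B s)^T).
  by move=> sab; apply: deriv_atM; [exact: dY|apply: deriv_at_tr; exact: dY].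
have ub s : s \in `[a, b] -> `|u' s| <= 2 * (C * d%:R) * u s.
  move=> sab; rewrite /u' mxE.
  have -> : (Y s *m (Y s *m B s)^T) 0 0 = (Y s *m B s *m (Y s)^T) 0 0.
    by rewrite -[Y s *m _]trmxK trmx_mul !trmxK mxE.
  rewrite -mulr2n normrMn -mulr_natl.
  by have := quad_form_bound (Y s) (HC s sab); rewrite /u; lra.
have uge0 s : 0 <= u s.
  by rewrite /u mxE sumr_ge0// => i _; rewrite mxE -expr2 sqr_ge0.
have u_cont : {within `[a, b], continuous u}.
  apply/subspace_continuousP => s sab.
  exact: (cvg_mxP _ _).1 (deriv_at_within_cvg (du s sab)) 0 0.
have u_der s : s \in `]a, b[ -> is_derive s 1 u (u' s).
  move=> sab; apply: deriv_at_is_derive => //.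
  by apply: du; exact: subset_itv_oo_cc.
pose D := 2 * (C * d%:R).
have e_der (c s : R) : is_derive s 1 (fun x => expR (c * x)) (c * expR (c * s)).
  by apply: is_derive_eq; rewrite /GRing.scale/=; ring.
have v_der (c s : R) : s \in `]a, b[ ->
    is_derive s 1 (u \* (fun x => expR (c * x)))
      ((u' s + c * u s) * expR (c * s)).
  move=> sab; have := u_der s sab => ?.
  by apply: is_derive_eq; rewrite /GRing.scale/=; ring.
have v_cont (c : R) :
    {within `[a, b], continuous (u \* (fun x => expR (c * x)))}.
  apply/subspace_continuousP => s sab; apply: cvgM.
    by move/subspace_continuousP : u_cont; exact.
  apply: cvg_within_filter.
  have := @ex_derive _ _ _ _ _ _ _ (e_der c s).
  by move=> /derivable1_diffP/differentiable_continuous.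
have u0 : u t0 = 0 by rewrite /u Y0 mul0mx mxE.
suff ut : u t <= 0.
  have : u t == 0 by rewrite eq_le ut uge0.
  rewrite /u mxE psumr_eq0 => [|i _]; last by rewrite mxE -expr2 sqr_ge0.
  move=> /allP Yt; apply/rowP => i; rewrite !mxE.
  by have := Yt i (mem_index_enum _); rewrite mxE -expr2 sqrf_eq0 => /eqP.
have [tt0|/ltW t0t] := leP t t0.
  rewrite -(pmulr_lle0 (u t) (expR_gt0 (D * t))).
  rewrite -[leRHS](mul0r (expR (D * t0))) -u0.
  apply: (ger0_derive1_le_cc _ _ (v_cont D) tab t0ab tt0) => s sab.
    exact: (@ex_derive _ _ _ _ _ _ _ (v_der D s sab)).
  rewrite derive1E (@derive_val _ _ _ _ _ _ _ (v_der D s sab)).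
  rewrite pmulr_lge0 ?expR_gt0//.
  have := ub s (subset_itv_oo_cc sab); rewrite ler_norml => /andP[].
  by rewrite -/D; lra.
rewrite -(pmulr_lle0 (u t) (expR_gt0 (- D * t))).
rewrite -[leRHS](mul0r (expR (- D * t0))) -u0.
apply: (ler0_derive1_le_cc _ _ (v_cont (- D)) tab t0ab t0t) => s sab.
  exact: (@ex_derive _ _ _ _ _ _ _ (v_der (- D) s sab)).
rewrite derive1E (@derive_val _ _ _ _ _ _ _ (v_der (- D) s sab)).
rewrite pmulr_lle0 ?expR_gt0//.
have := ub s (subset_itv_oo_cc sab); rewrite ler_norml => /andP[].
by rewrite -/D; lra.
Qed.

End Uniqueness.

(** * The Wronskian and its dual frame *)

Section Selectors.
Context {R : realType} {d n : nat}.

(** The j-th block of n rows of the identity matrix of size d * n: multiplying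
    by it on the left extracts the j-th block, and multiplying by its transpose
    on the right extracts the j-th block of columns. *)
Definition block_sel (j : nat) : 'M[R]_(n, d * n) :=
  \matrix_(m, p) ((p : nat) == j * n + m)%N%:R.

Lemma block_ltn j (m : 'I_n) : (j < d)%N -> (j * n + m < d * n)%N.
Proof.
move=> jd; apply: (@leq_trans (j.+1 * n)); last by rewrite leq_mul2r jd orbT.
by rewrite mulSn addnC ltn_add2r.
Qed.

Lemma block_inj i j (m m' : 'I_n) :
  (i * n + m == j * n + m')%N = (i == j) && (m == m').
Proof.
have n0 : (0 < n)%N by apply: leq_ltn_trans (ltn_ord m).
apply/eqP/andP => [e|[/eqP -> /eqP ->]//]; split; apply/eqP.
  by have := congr1 (divn^~ n) e; rewrite /= !divnMDl// !divn_small// !addn0.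
apply: val_inj.
by have := congr1 (modn^~ n) e; rewrite /= !modnMDl !modn_small.
Qed.

Lemma mul_block_sel (j : nat) q (x : 'M[R]_(d * n, q)) m c (jd : (j < d)%N) :
  (block_sel j *m x) m c = x (Ordinal (block_ltn m jd)) c.
Proof.
rewrite mxE (bigD1 (Ordinal (block_ltn m jd)))//= mxE eqxx mul1r big1 ?addr0//.
move=> p /negbTE pE; rewrite mxE.
by have -> : ((p : nat) == j * n + m)%N = false; rewrite ?mul0r.
Qed.

Lemma mul_block_sel_tr i j : (i < d)%N ->
  block_sel i *m (block_sel j)^T = if i == j then 1%:M else 0.
Proof.
move=> id; apply/matrixP => m m'; rewrite (mul_block_sel _ _ _ id).
rewrite !mxE/= block_inj.
by case: eqP => //= _; rewrite mxE.
Qed.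

Lemma block_sel_eq0 (x : 'cV[R]_(d * n)) :
  (forall j, (j < d)%N -> block_sel j *m x = 0) -> x = 0.
Proof.
move=> x0; apply/colP => p; rewrite mxE.
have n0 : (0 < n)%N.
  by rewrite lt0n; apply/eqP => n0; have := ltn_ord p; rewrite {2}n0 muln0.
have jd : (p %/ n < d)%N by rewrite ltn_divLR.
have := x0 _ jd => /colP/(_ (Ordinal (ltn_pmod p n0))).
rewrite (mul_block_sel _ _ _ jd) mxE => <-; congr (x _ _).
by apply: val_inj; rewrite /= -divn_eq.
Qed.

End Selectors.

Section Wronskian.
Context {R : realType} {d n : nat}.
Variables (a b : R).
Hypothesis ab : a < b.
Variable (A : R -> 'M[R]_(d * n, n)) (H : nat -> R -> 'M[R]_n).
Hypothesis A_smooth : smooth_on a b A.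
Hypothesis H_smooth : forall i, smooth_on a b (H i).
Hypothesis A_ode : forall t, t \in `[a, b] ->
  derivn_on a b d A t = \sum_(i < d) derivn_on a b i A t *m H i t.
Hypothesis A_free : forall c : 'rV[R]_(d * n),
  (forall t, t \in `[a, b] -> c *m A t = 0) -> c = 0.

Definition wronskian t : 'M[R]_(d * n) :=
  \sum_(j < d) derivn_on a b j A t *m block_sel j.

Lemma wronskian_block t j : (j < d)%N ->
  wronskian t *m (block_sel j)^T = derivn_on a b j A t.
Proof.
move=> jd; rewrite mulmx_suml (bigD1 (Ordinal jd))//= -mulmxA.
rewrite mul_block_sel_tr// eqxx.
rewrite mulmx1 big1 ?addr0// => i ij.
by rewrite -mulmxA mul_block_sel_tr// ifN ?mulmx0.
Qed.

Lemma smooth_on_derivn p q (f : R -> 'M[R]_(p, q)) j :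
  smooth_on a b f -> smooth_on a b (derivn_on a b j f).
Proof. by move=> fs m; apply: derivable_n_on_derivn; exact: fs. Qed.

Lemma wronskian_smooth : smooth_on a b wronskian.
Proof.
move=> m; apply: (derivable_n_on_sum ab) => j.
apply: (derivable_n_on_mul ab); first exact: smooth_on_derivn.
exact: derivable_n_on_cst.
Qed.

(** The derivative of the block A^(j) is the next block, and for j = d - 1 the
    equation expresses it through all blocks; both are W times a smooth
    matrix. *)
Lemma wronskian_ode : exists2 B : R -> 'M[R]_(d * n), smooth_on a b B &
  forall t, t \in `[a, b] -> deriv_at a b wronskian t (wronskian t *m B t).
Proof.
have /fin_all_exists2 [C Cs CE] (j : 'I_d) :
    exists2 C : R -> 'M[R]_(d * n, n), smooth_on a b C &
    forall t, t \in `[a, b] -> derivn_on a b j.+1 A t = wronskian t *m C t.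
  have [jd|dj] := ltnP j.+1 d.
    exists (fun=> (block_sel j.+1)^T) => [m|t _].
      by apply: derivable_n_on_cst.
    by rewrite wronskian_block.
  exists (fun t => \sum_(i < d) (block_sel i)^T *m H i t).
    move=> m; apply: (derivable_n_on_sum ab) => i.
    apply: (derivable_n_on_mul ab); last exact: H_smooth.
    exact: derivable_n_on_cst.
  move=> t tab; have -> : j.+1 = d by apply/eqP; rewrite eqn_leq dj ltn_ord.
  rewrite A_ode// mulmx_sumr; apply: eq_bigr => i _.
  by rewrite mulmxA wronskian_block.
exists (fun t => \sum_(j < d) C j t *m block_sel j).
  move=> m; apply: (derivable_n_on_sum ab) => j.
  by apply: (derivable_n_on_mul ab); [exact: Cs|exact: derivable_n_on_cst].
move=> t tab; rewrite mulmx_sumr; apply: deriv_at_sum => j.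
rewrite mulmxA -CE// -[X in deriv_at _ _ _ _ X]addr0.
rewrite -(mulmx0 _ (derivn_on a b j A t)).
apply: deriv_atM; last exact: deriv_at_cst.
exact: (derivn_deriv_at (@A_smooth j.+1) (ltnSn j) tab).
Qed.

(** If c W(t) = 0, then c W solves a linear first-order system with a zero, so
    it vanishes identically; its first block c A then vanishes, hence c = 0. *)
Lemma wronskian_unit t : t \in `[a, b] -> wronskian t \in unitmx.
Proof.
move=> tab; rewrite -row_free_unit; apply/inj_row_free => c cW.
have [B Bs WB] := wronskian_ode.
have cW0 s : s \in `[a, b] -> c *m wronskian s = 0.
  apply: (linear_ode_zero ab (Y := fun s => c *m wronskian s) (B := B) _ _ tab).
    move=> x xab; rewrite -mulmxA -[X in deriv_at _ _ _ _ X]add0r.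
    rewrite -(mul0mx _ (wronskian x)).
    by apply: deriv_atM; [exact: deriv_at_cst|exact: WB].
  by move=> x xab; exact: (Bs 1 0 x isT xab).
  by [].
case: (posnP d) => [d0|d0].
  by apply/rowP => p; have := ltn_ord p; rewrite {2}d0 mul0n.
apply: A_free => s sab.
by rewrite -[A s](wronskian_block s d0) mulmxA cW0// mul0mx.
Qed.

(** P_i is the i-th block of n rows of the inverse of the Wronskian. *)
Lemma dual_frame : exists2 P : nat -> R -> 'M[R]_(n, d * n),
  forall i, smooth_on a b (P i) &
  forall t i j, t \in `[a, b] -> (i < d)%N -> (j < d)%N ->
    P i t *m derivn_on a b j A t = if i == j then 1%:M else 0.
Proof.
exists (fun i t => block_sel i *m invmx (wronskian t)).
  move=> i m; apply: (derivable_n_on_mul ab); first exact: derivable_n_on_cst.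
  apply: (derivable_n_on_inv ab); last exact: wronskian_smooth.
  by move=> t; exact: wronskian_unit.
move=> t i j tab id jd; rewrite -(wronskian_block t jd) mulmxA.
by rewrite mulmxKV ?wronskian_unit// mul_block_sel_tr.
Qed.

End Wronskian.

(** * Linear differential operators of bounded order *)

Section DiffOp.
Context {R : realType} {n : nat}.
Variables (a b : R).
Hypothesis ab : a < b.
Variable K : nat.
Implicit Types (T : (R -> 'cV[R]_n) -> R -> 'cV[R]_n) (M : R -> 'M[R]_n).

(** Linear differential operators of order less than d with smooth coefficients,
    acting on functions that are K times differentiable on [a, b].  Keeping the
    coefficients existential avoids Leibniz's formula: only the leading
    coefficient matters. *)
Definition diffop_lt d T := exists2 N : nat -> R -> 'M[R]_n,
  forall i, smooth_on a b (N i) &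
  forall h t, derivable_n_on a b K h -> t \in `[a, b] ->
    T h t = \sum_(i < d) N i t *m derivn_on a b i h t.

Lemma eq_diffop_lt d T T' :
  (forall h t, derivable_n_on a b K h -> t \in `[a, b] -> T h t = T' h t) ->
  diffop_lt d T -> diffop_lt d T'.
Proof.
by move=> TT' [N Ns NT]; exists N => // h t hK tab; rewrite -TT' ?NT.
Qed.

Lemma diffop_lt_term d i M : (i < d)%N -> smooth_on a b M ->
  diffop_lt d (fun h t => M t *m derivn_on a b i h t).
Proof.
move=> id Ms; exists (fun j => if j == i then M else fun=> 0).
  by move=> j m; case: ifP => _; [exact: Ms|exact: derivable_n_on_cst].
move=> h t _ _; rewrite (bigD1 (Ordinal id)) //= eqxx big1 ?addr0// => j ji.
rewrite ifN ?mul0mx//.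
Qed.

Lemma diffop_lt_add d T T' : diffop_lt d T -> diffop_lt d T' ->
  diffop_lt d (fun h t => T h t + T' h t).
Proof.
move=> [N Ns NT] [N' Ns' NT']; exists (fun i s => N i s + N' i s).
  by move=> i m; exact: (derivable_n_on_add ab (Ns i m) (Ns' i m)).
move=> h t hK tab; rewrite (NT _ _ hK tab) (NT' _ _ hK tab) -big_split/=.
by apply: eq_bigr => i _; rewrite mulmxDl.
Qed.

Lemma diffop_lt0 d : diffop_lt d (fun _ _ => 0).
Proof.
exists (fun _ _ => 0) => [i m|h t _ _]; first exact: derivable_n_on_cst.
by rewrite big1// => i _; rewrite mul0mx.
Qed.

Lemma diffop_lt_sum (I : Type) (r : seq I) (P : pred I) d
    (U : I -> (R -> 'cV[R]_n) -> R -> 'cV[R]_n) :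
  (forall i, P i -> diffop_lt d (U i)) ->
  diffop_lt d (fun h t => \sum_(i <- r | P i) U i h t).
Proof.
move=> dT; elim: r => [|i r IH].
  by apply: eq_diffop_lt (diffop_lt0 d) => h t _ _; rewrite big_nil.
case: (boolP (P i)) => Pi.
  by apply: eq_diffop_lt (diffop_lt_add (dT i Pi) IH) => h t _ _;
     rewrite big_cons Pi.
by apply: eq_diffop_lt IH => h t _ _; rewrite big_cons (negbTE Pi).
Qed.

Lemma diffop_lt_mul d M T : smooth_on a b M -> diffop_lt d T ->
  diffop_lt d (fun h t => M t *m T h t).
Proof.
move=> Ms [N Ns NT]; exists (fun i s => M s *m N i s).
  by move=> i m; exact: (derivable_n_on_mul ab (Ms m) (Ns i m)).
move=> h t hK tab; rewrite (NT _ _ hK tab) mulmx_sumr.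
by apply: eq_bigr => i _; rewrite mulmxA.
Qed.

Lemma diffop_ltZ d (c : R) T : diffop_lt d T ->
  diffop_lt d (fun h t => c *: T h t).
Proof.
move=> dT; apply: (@eq_diffop_lt _ (fun h t => c%:M *m T h t)).
  by move=> h t _ _; rewrite mul_scalar_mx.
by apply: diffop_lt_mul => // m; exact: derivable_n_on_cst.
Qed.

Lemma diffop_ltW d d' T : (d <= d')%N -> diffop_lt d T -> diffop_lt d' T.
Proof.
move=> dd' [N Ns NT].
apply: (@eq_diffop_lt _
  (fun h t => \sum_(i < d) N i t *m derivn_on a b i h t)).
  by move=> h t hK tab; rewrite (NT _ _ hK tab).
apply: diffop_lt_sum => i _; apply: diffop_lt_term (Ns i).
exact: leq_trans dd'.
Qed.

Lemma diffop_lt_derivable d m T h : (d + m <= K.+1)%N -> diffop_lt d T ->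
  derivable_n_on a b K h -> derivable_n_on a b m (T h).
Proof.
move=> dmK [N Ns NT] hK.
apply: (@eq_derivable_n_on _ _ _ ab _ _
  (fun t => \sum_(i < d) N i t *m derivn_on a b i h t)).
  by move=> t tab; rewrite (NT _ _ hK tab).
apply: (derivable_n_on_sum ab) => i.
apply: (derivable_n_on_mul ab); first exact: (Ns i m).
apply: derivable_n_on_derivn; apply: derivable_n_onW hK.
by rewrite -ltnS; apply: leq_trans dmK; rewrite addnC ltn_add2r.
Qed.

Lemma diffop_lt_deriv d T : (d <= K)%N -> diffop_lt d T ->
  diffop_lt d.+1 (fun h => deriv_on a b (T h)).
Proof.
move=> dK [N Ns NT].
apply: (@eq_diffop_lt _ (fun h t => \sum_(i < d)
    (deriv_on a b (N i) t *m derivn_on a b i h t +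
     N i t *m derivn_on a b i.+1 h t))).
  move=> h t hK tab; symmetry; apply: (deriv_onE ab tab).
  apply: (@eq_deriv_at _ _ _ _ _
    (fun t => \sum_(i < d) N i t *m derivn_on a b i h t) _ _ _ tab).
    by move=> s sab; rewrite (NT _ _ hK sab).
  apply: deriv_at_sum => i; apply: deriv_atM.
    exact: (deriv_atS (Ns i 1) tab).
  by apply: (derivn_deriv_at hK _ tab); exact: leq_trans dK.
apply: diffop_lt_sum => i _; apply: diffop_lt_add.
  apply: diffop_lt_term; first by rewrite ltnS ltnW.
  by move=> m; apply: derivable_n_on_deriv; exact: (Ns i m.+1).
by apply: diffop_lt_term; [rewrite ltnS|exact: Ns].
Qed.

Lemma diffop_lt_derivn d j T : (d + j <= K.+1)%N -> diffop_lt d T ->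
  diffop_lt (d + j) (fun h => derivn_on a b j (T h)).
Proof.
move=> + dT; elim: j => [|j IH] djK; first by rewrite addn0.
rewrite addnS in djK *; apply: diffop_lt_deriv => //.
exact: IH (ltnW djK).
Qed.

(** Differentiating M h^(i) repeatedly, the only term in which all derivatives
    fall on h is M h^(i+j). *)
Lemma derivn_on_leading M i j : smooth_on a b M -> (i + j <= K)%N ->
  diffop_lt (i + j) (fun h t =>
    derivn_on a b j (fun s => M s *m derivn_on a b i h s) t -
    M t *m derivn_on a b (i + j) h t).
Proof.
move=> Ms; elim: j => [|j IH] ijK.
  rewrite addn0; apply: eq_diffop_lt (diffop_lt0 i) => h t _ _.
  by rewrite derivn_on0 subrr.
rewrite addnS in ijK *.
have {}IH := IH (ltnW ijK).
have M's : smooth_on a b (deriv_on a b M).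
  by move=> m; apply: derivable_n_on_deriv; exact: (Ms m.+1).
apply: eq_diffop_lt (diffop_lt_add (diffop_lt_deriv (ltnW ijK) IH)
  (diffop_lt_term (ltnSn (i + j)) M's)) => h t hK tab.
set f := fun s => M s *m derivn_on a b i h s.
have ft : deriv_at a b (derivn_on a b j f) t (derivn_on a b j.+1 f t).
  apply: (derivn_deriv_at (m := j.+1)) => //.
  apply: (derivable_n_on_mul ab); first exact: Ms.
  apply: derivable_n_on_derivn; apply: derivable_n_onW hK.
  by rewrite addSn addnC.
have gt := deriv_atM (deriv_atS (Ms 1) tab) (derivn_deriv_at hK ijK tab).
have g't := deriv_atM (@deriv_at_cst _ a b _ _ (- 1%:M) t) gt.
rewrite (deriv_onE ab tab
  (l := derivn_on a b j.+1 f t - (deriv_on a b M t *m derivn_on a b (i + j) h t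
     + M t *m derivn_on a b (i + j).+1 h t))).
  by rewrite opprD addrA addrAC subrK.
have := deriv_atD ft g't; rewrite mul0mx add0r mulNmx mul1mx.
by apply: eq_deriv_at => // s _; rewrite mulNmx mul1mx.
Qed.

End DiffOp.

(** * The gradient of the Lagrangian *)

Section Gradient.
Context {R : realType} {n : nat}.
Variables (k : nat) (Mdiag Moff : nat -> R -> 'M[R]_n).
Implicit Types (q p : nat -> 'cV[R]_n).

(** The symmetric bilinear form polarizing the quadratic form [lagrangian t]. *)
Definition lagrangian_polar t q p : R :=
  2^-1 * (\sum_(i < k.+1) (((p i)^T *m Mdiag i t *m q i) 0 0 +
                            ((q i)^T *m Mdiag i t *m p i) 0 0))
  + \sum_(i < k) (((p i)^T *m Moff i t *m q i.+1) 0 0 +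
                  ((q i)^T *m Moff i t *m p i.+1) 0 0).

Lemma bilin_line (M : 'M[R]_n) (u v w z : 'cV[R]_n) (s : R) :
  ((u + s *: v)^T *m M *m (w + s *: z)) 0 0 =
  (u^T *m M *m w) 0 0 + s * ((v^T *m M *m w) 0 0 + (u^T *m M *m z) 0 0) +
  s ^+ 2 * (v^T *m M *m z) 0 0.
Proof.
have -> : (u + s *: v)^T = u^T + s *: v^T by rewrite linearD linearZ.
rewrite !mulmxDl !mulmxDr -!scalemxAl -!scalemxAr !mxE.
ring.
Qed.

Lemma lagrangian_line t q p s :
  lagrangian k Mdiag Moff t (fun i => q i + s *: p i) =
  lagrangian k Mdiag Moff t q + s * lagrangian_polar t q p +
  s ^+ 2 * lagrangian k Mdiag Moff t p.
Proof.
rewrite /lagrangian /lagrangian_polar.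
under eq_bigr do rewrite bilin_line.
under [X in _ + X = _]eq_bigr do rewrite bilin_line.
rewrite !big_split /= -!mulr_sumr !big_split /=.
ring.
Qed.

Lemma derive1_quadratic (c0 c1 c2 : R) :
  derive1 (fun s : R => c0 + s * c1 + s ^+ 2 * c2) 0 = c1.
Proof.
rewrite derive1E.
have D : is_derive (0 : R) (1 : R) (fun s : R => c0 + s * c1 + s ^+ 2 * c2) c1.
  apply: is_derive_eq.
  by rewrite /GRing.scale /=; ring.
exact: derive_val.
Qed.

(** L is quadratic in q, so its directional derivative at q is its polar form.
    The symmetry of M_jj merges the two diagonal terms. *)
Lemma lagrangian_gradE j t q : (j <= k)%N -> (Mdiag j t)^T = Mdiag j t ->
  lagrangian_grad k Mdiag Moff j t q =
  Mdiag j t *m q j + (if (j < k)%N then Moff j t *m q j.+1 else 0) +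
  (if (0 < j)%N then (Moff j.-1 t)^T *m q j.-1 else 0).
Proof.
move=> jk Mt; apply/colP => m.
rewrite [LHS]mxE [RHS]mxE [X in _ = X + _]mxE.
pose p i : 'cV[R]_n := if i == j then delta_mx m 0 else 0.
have -> : (fun s => lagrangian k Mdiag Moff t
            (fun i => if i == j then q i + s *: delta_mx m 0 else q i)) =
  (fun s => lagrangian k Mdiag Moff t q + s * lagrangian_polar t q p +
  s ^+ 2 * lagrangian k Mdiag Moff t p).
  apply/funext => s; rewrite -lagrangian_line; congr lagrangian.
  by apply/funext => i; rewrite /p; case: ifP => _ //; rewrite scaler0 addr0.
rewrite derive1_quadratic /lagrangian_polar.
have pl (M : 'M[R]_n) i (v : 'cV[R]_n) :
    ((p i)^T *m M *m v) 0 0 = if i == j then (M *m v) m 0 else 0.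
  rewrite /p; case: ifP => _; last by rewrite trmx0 !mul0mx mxE.
  by rewrite trmx_delta -mulmxA -rowE mxE.
have pr (M : 'M[R]_n) i (v : 'cV[R]_n) :
    (v^T *m M *m p i) 0 0 = if i == j then (M^T *m v) m 0 else 0.
  rewrite /p; case: ifP => _; last by rewrite !mulmx0 mxE.
  by rewrite -colE mxE -[v^T *m M]trmxK trmx_mul trmxK mxE.
rewrite -addrA; congr (_ + _).
  rewrite (bigD1 (Ordinal (jk : (j < k.+1)%N)))//= pl pr eqxx Mt.
  rewrite big1 => [|i ij]; last by rewrite pl pr !ifN // addr0.
  by rewrite addr0; field.
rewrite big_split /=; congr (_ + _).
  under eq_bigr do rewrite pl; rewrite -big_mkcond.
  case: ifPn => [jk'|kj]; first by rewrite (big_pred1 (Ordinal jk')).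
  rewrite mxE big_pred0// => i; apply: contraNF kj => /eqP <-.
  exact: ltn_ord.
under eq_bigr do rewrite pr; rewrite -big_mkcond.
case: j jk {Mt pl pr} @p => [|j] jk p.
  by rewrite mxE big_pred0.
by rewrite (big_pred1 (Ordinal jk)).
Qed.

End Gradient.

(** * Normal form of the Jacobi equation *)

Section NormalForm.
Context {R : realType} {n : nat}.
Variables (a b : R) (k : nat) (Mdiag Moff : nat -> R -> 'M[R]_n).
Hypothesis ab : a < b.
Hypothesis k0 : (0 < k)%N.
Hypothesis Mdiag_smooth : forall i, (i <= k)%N -> smooth_on a b (Mdiag i).
Hypothesis Moff_smooth : forall i, (i < k)%N -> smooth_on a b (Moff i).
Hypothesis Mdiag_sym :
  forall i t, (i <= k)%N -> t \in `[a, b] -> (Mdiag i t)^T = Mdiag i t.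
Hypothesis Mdiag_posdef : forall t, t \in `[a, b] -> posdef (Mdiag k t).

Lemma smooth_on_tr p q (f : R -> 'M[R]_(p, q)) :
  smooth_on a b f -> smooth_on a b (fun s => (f s)^T).
Proof. by move=> fs m; apply: (derivable_n_on_tr ab (fs m)). Qed.

Let momentum j (h : R -> 'cV[R]_n) s :=
  lagrangian_grad k Mdiag Moff j s (fun i => derivn_on a b i h s).

Lemma momentum_lt K j : (j < k)%N -> diffop_lt a b K j.+2 (momentum j).
Proof.
move=> jk; apply: (@eq_diffop_lt _ _ _ _ _ _ (fun h s =>
    Mdiag j s *m derivn_on a b j h s + Moff j s *m derivn_on a b j.+1 h s +
    (if (0 < j)%N then (Moff j.-1 s)^T *m derivn_on a b j.-1 h s else 0))).
  move=> h t _ tab.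
  by rewrite /momentum lagrangian_gradE ?jk ?Mdiag_sym ?(ltnW jk).
apply: (diffop_lt_add ab) => //; first apply: (diffop_lt_add ab) => //.
- by apply: (diffop_lt_term ab); [lia|exact/Mdiag_smooth/ltnW].
- by apply: (diffop_lt_term ab); [lia|exact/Moff_smooth].
case: j jk => [|j] jk; first exact: (diffop_lt0 ab).
apply: (diffop_lt_term ab); first by lia.
exact/smooth_on_tr/Moff_smooth/ltnW.
Qed.

Lemma momentum_top h t : t \in `[a, b] -> momentum k h t =
  Mdiag k t *m derivn_on a b k h t +
  (Moff k.-1 t)^T *m derivn_on a b k.-1 h t.
Proof.
by move=> tab; rewrite /momentum lagrangian_gradE ?Mdiag_sym// ltnn k0 addr0.
Qed.

(** For j < k the j-th term of the equation has order at most 2j + 1 < 2k, so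
    only the term j = k, through M_kk h^(k), reaches order 2k. *)
Lemma jacobi_lhs_leading : diffop_lt a b (2 * k) (2 * k) (fun h t =>
  jacobi_lhs a b k Mdiag Moff h t -
  (-1) ^+ k *: (Mdiag k t *m derivn_on a b (2 * k) h t)).
Proof.
have kk : (2 * k = k + k)%N by rewrite mul2n addnn.
have Msm : smooth_on a b (fun s => (Moff k.-1 s)^T).
  by apply/smooth_on_tr/Moff_smooth; rewrite prednK.
have dlow : diffop_lt a b (2 * k) k
    (fun h s => (Moff k.-1 s)^T *m derivn_on a b k.-1 h s).
  by apply: (diffop_lt_term ab); rewrite ?prednK.
apply: (@eq_diffop_lt _ _ _ _ _ _ (fun h t =>
  \sum_(j < k) (-1) ^+ j *: derivn_on a b j (momentum j h) t +
  (-1) ^+ k *: ((derivn_on a b k (fun s => Mdiag k s *m derivn_on a b k h s) t -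
     Mdiag k t *m derivn_on a b (k + k) h t) +
   derivn_on a b k (fun s => (Moff k.-1 s)^T *m derivn_on a b k.-1 h s) t))).
  move=> h t hK tab.
  rewrite /jacobi_lhs big_ord_recr/= -[RHS]addrA; congr (_ + _).
  rewrite -scalerBr; congr (_ *: _).
  rewrite -/(momentum k h) [in RHS](eq_derivn_on (f := momentum k h) k
     (fun s sab => momentum_top h sab) tab).
  rewrite (derivn_on_add ab _ _ tab) ?kk; first by rewrite addrAC.
    apply: (derivable_n_on_mul ab); first exact: Mdiag_smooth.
    by apply: derivable_n_on_derivn; rewrite -kk.
  by apply: (diffop_lt_derivable ab _ dlow hK); rewrite -kk.
apply: (diffop_lt_add ab).
  apply: (diffop_lt_sum ab) => j _; apply: (diffop_ltZ ab).
  apply: (diffop_ltW ab) (diffop_lt_derivn ab _ (momentum_lt _ (ltn_ord j))).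
    by have := ltn_ord j; lia.
  by have := ltn_ord j; lia.
apply: (diffop_ltZ ab); apply: (diffop_lt_add ab).
  rewrite {2}kk; apply: (derivn_on_leading ab (Mdiag_smooth _)) => //.
  by rewrite kk.
by rewrite {2}kk; apply: (diffop_lt_derivn ab) => //; rewrite kk.
Qed.

(** A kernel vector of S would make the quadratic form vanish. *)
Lemma posdef_unitmx (S : 'M[R]_n) : posdef S -> S \in unitmx.
Proof.
move=> Spos; rewrite -unitmx_tr -row_free_unit; apply/inj_row_free => v vS.
apply/eqP; apply: contraT => v0.
have vT0 : v^T != 0 by rewrite -(inj_eq trmx_inj) trmxK trmx0.
have := Spos _ vT0.
by rewrite -mulmxA -[S]trmxK -trmx_mul vS trmx0 mulmx0 mxE ltxx.
Qed.

(** The coefficient (-1)^k M_kk of h^(2k) is invertible, so the equation can be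
    solved for the highest derivative. *)
Lemma jacobi_normal_form : exists2 G : nat -> R -> 'M[R]_n,
  forall i, smooth_on a b (G i) &
  forall h, jacobi_solution a b k Mdiag Moff h -> forall t, t \in `[a, b] ->
    derivn_on a b (2 * k) h t = \sum_(i < 2 * k) G i t *m derivn_on a b i h t.
Proof.
have [N Ns NT] := jacobi_lhs_leading.
have Mu : {in `[a, b], forall s, Mdiag k s \in unitmx}.
  by move=> s sab; exact/posdef_unitmx/Mdiag_posdef.
(* (-1)^k is its own inverse. *)
pose c : 'M[R]_n := (- (-1) ^+ k)%:M.
exists (fun i s => c *m (invmx (Mdiag k s) *m N i s)).
  move=> i m; apply: (derivable_n_on_mul ab); first exact: derivable_n_on_cst.
  apply: (derivable_n_on_mul ab); last exact: Ns.
  by apply: (derivable_n_on_inv ab Mu); exact: Mdiag_smooth.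
move=> h [hK heq] t tab; have := NT h t hK tab.
rewrite heq// sub0r => E.
under eq_bigr do rewrite -!mulmxA.
rewrite -!mulmx_sumr -E mulmxN -scalemxAr mulKmx ?Mu//.
rewrite /c mul_scalar_mx scalerN scaleNr opprK scalerA -exprMn mulrNN mulr1.
by rewrite expr1n scale1r.
Qed.

(** Bootstrapping: if h is m + 2k times differentiable, the right-hand side of
    the normal form is m + 1 times differentiable, hence so is h^(2k). *)
Lemma jacobi_smooth (h : R -> 'cV[R]_n) : jacobi_solution a b k Mdiag Moff h ->
  smooth_on a b h.
Proof.
move=> hsol; have [G Gs Gh] := jacobi_normal_form.
have [hK _] := hsol.
(* Each step gains one order over the 2k derivatives known at the start. *)
suff hm m : derivable_n_on a b (m + 2 * k) h.
  by move=> m; apply: derivable_n_onW (hm m); rewrite leq_addr.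
elim: m => [//|m IH].
apply: derivable_n_onD => //.
apply: (@eq_derivable_n_on _ _ _ ab _ _
  (fun t => \sum_(i < 2 * k) G i t *m derivn_on a b i h t)).
  by move=> t tab; rewrite Gh.
apply: (derivable_n_on_sum ab) => i; apply: (derivable_n_on_mul ab).
  exact: Gs.
apply: derivable_n_on_derivn; apply: derivable_n_onW IH.
by rewrite addSnnS leq_add2l.
Qed.

End NormalForm.

(** * Curves of column spaces and their rank *)

Section ColumnSpan.
Context {R : realType} {N q : nat}.
Implicit Type B : 'M[R]_(N, q).

Lemma mulmx_sum_col B (x : 'cV[R]_q) : B *m x = \sum_j x j 0 *: col j B.
Proof.
apply/colP => i; rewrite mxE summxE; apply: eq_bigr => j _.
by rewrite !mxE mulrC.
Qed.

Lemma mem_col_span B v : v \in col_span B <-> exists x : 'cV[R]_q, v = B *m x.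
Proof.
have -> : col_span B = <<[tuple col j B | j < q]>>%VS.
  by [].
split=> [/coord_span vE|[x ->]].
  exists (\col_j coord [tuple col j B | j < q] j v).
  rewrite mulmx_sum_col {1}vE; apply: eq_bigr => j _.
  by rewrite mxE -tnth_nth tnth_mktuple.
rewrite mulmx_sum_col; apply: memv_suml => j _; apply: memvZ.
by apply: memv_span; apply/tnthP; exists j; rewrite tnth_mktuple.
Qed.

Lemma free_cols B : (forall x : 'cV[R]_q, B *m x = 0 -> x = 0) ->
  free [seq col j B | j <- enum 'I_q].
Proof.
move=> Binj; rewrite (_ : [seq _ | _ <- _] = [tuple col j B | j < q]).
  apply/freeP => c c0 j.
  suff /colP/(_ j) : \col_j c j = 0 :> 'cV[R]_q by rewrite !mxE.
  apply: Binj; rewrite mulmx_sum_col -[RHS]c0; apply: eq_bigr => i _.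
  by rewrite mxE -tnth_nth tnth_mktuple.
by [].
Qed.

End ColumnSpan.

Section FramedCurve.
Context {R : realType} {N n : nat}.
Variables (a b : R).
Hypothesis ab : a < b.
Variables (k : nat) (A : R -> 'M[R]_(N, n)) (P : nat -> R -> 'M[R]_(n, N)).
Variable l : R -> {vspace 'cV[R]_N}.
Hypothesis k0 : (0 < k)%N.
Hypothesis A_smooth : smooth_on a b A.
Hypothesis P_smooth : forall i, smooth_on a b (P i).
Hypothesis P_dual : forall t i j, t \in `[a, b] -> (i <= k)%N -> (j <= k)%N ->
  P i t *m derivn_on a b j A t = if i == j then 1%:M else 0.
Hypothesis mem_l : forall t v, v \in l t <->
  exists x : 'I_k -> 'cV[R]_n, v = \sum_(j < k) derivn_on a b j A t *m x j.

Lemma dual_coord t i (x : 'I_k -> 'cV[R]_n) : t \in `[a, b] -> (i <= k)%N ->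
  P i t *m (\sum_(j < k) derivn_on a b j A t *m x j) =
  \sum_(j < k | i == j :> nat) x j.
Proof.
move=> tab ik; rewrite mulmx_sumr [RHS]big_mkcond; apply: eq_bigr => j _.
rewrite mulmxA P_dual//; last exact: ltnW.
by case: eqP; rewrite ?mul1mx ?mul0mx.
Qed.

Lemma dual_coord_ord t (i : 'I_k) (x : 'I_k -> 'cV[R]_n) : t \in `[a, b] ->
  P i t *m (\sum_(j < k) derivn_on a b j A t *m x j) = x i.
Proof.
move=> tab; rewrite dual_coord//; last exact: ltnW.
by rewrite (big_pred1 i)// => j; rewrite eq_sym.
Qed.

Lemma dual_coord_top t (x : 'I_k -> 'cV[R]_n) : t \in `[a, b] ->
  P k t *m (\sum_(j < k) derivn_on a b j A t *m x j) = 0.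
Proof.
by move=> tab; rewrite dual_coord// big_pred0// => j; rewrite gtn_eqF.
Qed.

Lemma mem_derivn t j (x : 'cV[R]_n) : (j < k)%N ->
  derivn_on a b j A t *m x \in l t.
Proof.
move=> jk; apply/mem_l; exists (fun i => if i == Ordinal jk then x else 0).
rewrite (bigD1 (Ordinal jk))//= eqxx big1 ?addr0// => i ij.
by rewrite ifN ?mulmx0.
Qed.

(** The columns of the blocks A^(j), j < k, span l(t) by assumption and are
    independent because the dual blocks P_j read off the coefficients. *)
Lemma frame_smooth : smooth_gr_curve a b l (k * n).
Proof.
pose E t : 'M[R]_(N, k * n) := \sum_(j < k) derivn_on a b j A t *m block_sel j.
exists (fun p t => col p (E t)).
  move=> p m; apply: (@eq_derivable_n_on _ _ _ ab _ _
    (fun t => E t *m delta_mx p 0)); first by move=> t _; rewrite colE.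
  apply: (derivable_n_on_mul ab); last exact: derivable_n_on_cst.
  apply: (derivable_n_on_sum ab) => j.
  apply: (derivable_n_on_mul ab); last exact: derivable_n_on_cst.
  exact: (smooth_on_derivn (@A_smooth)).
move=> t tab.
have mulE (x : 'cV[R]_(k * n)) :
    E t *m x = \sum_(j < k) derivn_on a b j A t *m (block_sel j *m x).
  by rewrite mulmx_suml; apply: eq_bigr => j _; rewrite mulmxA.
apply/andP; split; last first.
  apply: free_cols => x; rewrite mulE => Ex0.
  apply: block_sel_eq0 => j jk.
  rewrite -(dual_coord_ord (Ordinal jk) (fun j : 'I_k => block_sel j *m x) tab).
  by rewrite Ex0 mulmx0.
apply/eqP/vspaceP => v; apply/idP/idP => [|/mem_l [x ->]].
  move=> /(mem_col_span (E t)) [x ->]; apply/mem_l.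
  by exists (fun j => block_sel j *m x); rewrite mulE.
apply/(mem_col_span (E t)); exists (\sum_(i < k) (block_sel i)^T *m x i).
rewrite mulmx_sumr; apply: eq_bigr => i _; rewrite mulmxA; congr (_ *m _).
rewrite mulmx_suml (bigD1 i)//= -mulmxA mul_block_sel_tr// eqxx mulmx1.
rewrite big1 ?addr0//.
by move=> j ji; rewrite -mulmxA mul_block_sel_tr// ifN ?mulmx0.
Qed.

Lemma section_smooth (x : 'I_k -> 'cV[R]_n) : smooth_section a b l
  (fun s => \sum_(j < k) derivn_on a b j A s *m x j).
Proof.
split=> [m|t _]; last by apply/mem_l; exists x.
apply: (derivable_n_on_sum ab) => j.
apply: (derivable_n_on_mul ab); last exact: derivable_n_on_cst.
exact: (smooth_on_derivn (@A_smooth)).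
Qed.

(** Differentiate f = sum_(j < k) A^(j) (P_j f).  The terms A^(j) (P_j f)'
    lie in l(t), and so do the terms A^(j+1) P_j f with j + 1 < k. *)
Lemma section_deriv (f : R -> 'cV[R]_N) t : smooth_section a b l f ->
  t \in `[a, b] ->
  deriv_on a b f t - derivn_on a b k A t *m (P k.-1 t *m f t) \in l t.
Proof.
move=> [fs fl] tab.
have fE : {in `[a, b],
    (fun s => \sum_(j < k) derivn_on a b j A s *m (P j s *m f s)) =1 f}.
  move=> s sab; have /mem_l [x fx] := fl s sab; rewrite [RHS]fx.
  by apply: eq_bigr => j _; rewrite fx dual_coord_ord.
pose z j := deriv_on a b (fun s => P j s *m f s) t.
have dP j : deriv_at a b (fun s => P j s *m f s) t (z j).
  apply: (@deriv_atS _ _ _ _ _ _ 0) => //.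
  by apply: (derivable_n_on_mul ab); [exact: P_smooth|exact: fs].
have dA j : deriv_at a b (derivn_on a b j A) t (derivn_on a b j.+1 A t).
  exact: (derivn_deriv_at (@A_smooth j.+1) (ltnSn j) tab).
have df : deriv_at a b f t (\sum_(j < k)
    (derivn_on a b j.+1 A t *m (P j t *m f t) + derivn_on a b j A t *m z j)).
  apply: eq_deriv_at fE _ => //.
  by apply: deriv_at_sum => j; apply: deriv_atM.
rewrite (deriv_onE ab tab df) big_split/= addrAC.
apply: memvD; last by apply: memv_suml => j _; exact: mem_derivn.
(* Removing the last term, A^(k) P_(k-1) f, leaves terms of l(t). *)
case: k k0 mem_derivn => // k' _ memA.
rewrite big_ord_recr/= addrK; apply: memv_suml => j _.
by apply: (memA t j.+1); rewrite ltnS.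
Qed.

(** The velocity of l at t is v |-> [A^(k)(t) P_(k-1)(t) v].  Since
    P_(k-1) A^(k-1) = 1, its image is that of x |-> [A^(k)(t) x], and this map
    is injective: applying P_k to A^(k) x in l(t) gives x = 0. *)
Lemma frame_rank t : t \in `[a, b] -> curve_rank_eq a b l t n.
Proof.
move=> tab.
pose Ak := derivn_on a b k A t.
pose g : 'Hom('cV[R]_n, quot_space (l t)) :=
  (quot_proj (l t) \o linfun (mulmx Ak))%VF.
have gE x : g x = quot_proj (l t) (Ak *m x).
  by rewrite comp_lfunE [linfun _ x]lfunE.
pose c : 'Hom(subvs_of (l t), 'cV[R]_n) :=
  (linfun (mulmx (P k.-1 t)) \o linfun vsval)%VF.
have cE v : c v = P k.-1 t *m vsval v by rewrite comp_lfunE !lfunE.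
pose D : 'Hom(subvs_of (l t), quot_space (l t)) := (g \o c)%VF.
have DE v : D v = quot_proj (l t) (Ak *m (P k.-1 t *m vsval v)).
  by rewrite comp_lfunE gE cE.
have k1k : (k.-1 < k)%N by rewrite prednK.
exists D.
  move=> v; split.
    have /mem_l [x vx] := subvsP v.
    by eexists; [exact: (section_smooth x)|rewrite vx].
  move=> f fs ft; rewrite DE -ft; apply/eqP; rewrite eq_sym -subr_eq0 -linearB.
  by rewrite -memv_ker quot_proj_lker; exact: section_deriv.
have limgE : limg D = limg g.
  apply/eqP; rewrite eqEsubv; apply/andP; split.
    by apply/subvP => _ /memv_imgP [v _ ->]; rewrite comp_lfunE memv_img ?memvf.
  apply/subvP => _ /memv_imgP [x _ ->].
  pose v := vsproj (l t) (derivn_on a b k.-1 A t *m x).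
  have -> : g x = D v.
    rewrite gE DE vsprojK ?mem_derivn// (mulmxA (P _ _)).
    by rewrite P_dual ?leq_pred// eqxx mul1mx.
  by rewrite memv_img ?memvf.
rewrite limgE limg_dim_eq ?dimvf; first by rewrite /dim /= muln1.
apply/eqP; rewrite capfv -subv0; apply/subvP => x; rewrite memv_ker memv0 gE.
rewrite -memv_ker quot_proj_lker => /mem_l [y xy]; apply/eqP.
have := congr1 (mulmx (P k t)) xy.
by rewrite dual_coord_top// mulmxA P_dual// eqxx mul1mx.
Qed.

End FramedCurve.

Theorem theorem4p10 (R : realType) (a b : R) (k n : nat)
  (Mdiag Moff : nat -> R -> 'M[R]_n)
  (h : 'I_(2 * k * n) -> R -> 'cV[R]_n) :
  a < b -> (0 < k)%N -> (0 < n)%N ->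
  (forall i, (i <= k)%N -> smooth_on a b (Mdiag i)) ->
  (forall i, (i < k)%N -> smooth_on a b (Moff i)) ->
  (forall i t, (i <= k)%N -> t \in `[a, b] -> (Mdiag i t)^T = Mdiag i t) ->
  (forall t, t \in `[a, b] -> posdef (Mdiag k t)) ->
  fundamental_set a b k Mdiag Moff h ->
  (forall (i : 'I_(2 * k * n)) (j : nat), (i < k * n)%N -> (j < k)%N ->
     derivn_on a b j (h i) a = 0) ->
  smooth_gr_curve a b (jacobi_curve a b k h) (k * n) /\
  forall t, t \in `[a, b] -> curve_rank_eq a b (jacobi_curve a b k h) t n.
Proof.
move=> ab k0 _ Mdiag_smooth Moff_smooth Mdiag_sym Mdiag_posdef.
move=> [h_sol h_free _] _.
have [G G_smooth G_eq] :=
  jacobi_normal_form ab k0 Mdiag_smooth Moff_smooth Mdiag_sym Mdiag_posdef.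
have h_smooth i : smooth_on a b (h i).
  exact: (jacobi_smooth ab k0 Mdiag_smooth Moff_smooth Mdiag_sym Mdiag_posdef).
have rows m := derivn_on_rows ab (fun i => h_smooth i m).
have A_smooth : smooth_on a b (sol_mx h) by move=> m; exact: (rows m).1.
have A_derivn j t : t \in `[a, b] ->
    derivn_on a b j (sol_mx h) t = \matrix_(i, c) derivn_on a b j (h i) t c 0.
  by move=> tab; exact: (rows j).2.
have A_ode t : t \in `[a, b] -> derivn_on a b (2 * k) (sol_mx h) t =
    \sum_(i < 2 * k) derivn_on a b i (sol_mx h) t *m (G i t)^T.
  move=> tab; rewrite A_derivn//; apply/matrixP => r c.
  rewrite mxE G_eq//; rewrite !summxE; apply: eq_bigr => i _.
  rewrite A_derivn// !mxE; apply: eq_bigr => m _.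
  by rewrite !mxE mulrC.
have A_free (c : 'rV[R]_(2 * k * n)) :
    (forall t, t \in `[a, b] -> c *m sol_mx h t = 0) -> c = 0.
  move=> cA; apply/rowP => i; rewrite mxE; move: i.
  apply: h_free => t tab; apply/colP => m; rewrite summxE [RHS]mxE.
  have /rowP/(_ m) := cA t tab; rewrite !mxE => c0; rewrite -[RHS]c0.
  by apply: eq_bigr => i _; rewrite !mxE.
have [P P_smooth P_dual] := dual_frame ab A_smooth
  (fun i => smooth_on_tr ab (G_smooth i)) A_ode A_free.
have le2k i : (i <= k)%N -> (i < 2 * k)%N by move=> ik; lia.
have mem_l t v : v \in jacobi_curve a b k h t <->
    exists x : 'I_k -> 'cV[R]_n,
      v = \sum_(j < k) derivn_on a b j (sol_mx h) t *m x j.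
  rewrite /jacobi_curve mem_col_span; split=> [[x ->]|[x ->]].
    exists (fun j => submxcol x j).
    by rewrite -{1}(submxcolK x) mul_mxrow_mxcol.
  by exists (\mxcol_j x j); rewrite mul_mxrow_mxcol.
have P_dual' t i j (tab : t \in `[a, b]) (ik : (i <= k)%N) (jk : (j <= k)%N) :=
  P_dual t i j tab (le2k i ik) (le2k j jk).
split; first exact: (frame_smooth ab A_smooth P_dual' mem_l).
by move=> t tab; apply: (frame_rank ab k0 A_smooth P_smooth P_dual' mem_l).
Qed.
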